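(* Let $\mathfrak{g}_{5,3}$ be the real Lie algebra with basis $a,b,c,d,e$ and nonzero brackets $[a,b]=d$, $[a,d]=e$, $[b,c]=e$ (up to skew-symmetry). Then $\mathfrak{g}_{5,3}$ is rigid in the variety $\mathcal{N}_{5,3}$, but $H^2_{3\text{-}nil}(\mathfrak{g}_{5,3},\mathfrak{g}_{5,3})\neq0$; in fact it has dimension $2$ and is spanned by the classes of $\nu_1,\nu_2\in\Lambda^2\mathfrak{g}_{5,3}^*\otimes\mathfrak{g}_{5,3}$ given (on basis elements, all other values not determined by skew-symmetry being zero) by $\nu_1(b,c)=c$ and $\nu_2(a,b)=b$, $\nu_2(a,c)=-c$, $\nu_2(a,d)=-d$.
   Context: For an $n$-dimensional real vector space $\mathfrak{g}$ and $\sigma\in\Lambda^2\mathfrak{g}^*\otimes\mathfrak{g}$ put $J(\sigma)(x,y,z)=\sum_{cyclic}\sigma(\sigma(x,y),z)$, $N_1(\sigma)(x_1,x_2)=\sigma(x_1,x_2)$ and $N_k(\sigma)(x_1,\dots,x_{k+1})=\sigma(N_{k-1}(\sigma)(x_1,\dots,x_k),x_{k+1})$. $\mathcal{N}_{n,k}=\{\sigma: J(\sigma)=0,\ N_k(\sigma)=0\}$ is the variety of (at most) $k$-step nilpotent Lie algebra structures on $\mathfrak{g}$. The group $GL(\mathfrak{g})$ acts by $(g\cdot\mu)(x,y)=g(\mu(g^{-1}x,g^{-1}y))$, and $\mu$ is rigid in $\mathcal{N}_{n,k}$ if its orbit is open in $\mathcal{N}_{n,k}$ (equivalently in the metric or Zariski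 topology). For $\mu\in\mathcal{N}_{n,k}$, $$H^2_{k\text{-}nil}(\mathfrak{g},\mathfrak{g})=\frac{\mathrm{Ker}(d^2_\mu)\cap\mathrm{Ker}(dN_k|_\mu)}{\mathrm{Im}(d^1_\mu)},$$ where $d^1_\mu,d^2_\mu$ are the Chevalley–Eilenberg differentials of $(\mathfrak{g},\mu)$ with adjoint coefficients (on $\mathfrak{g}^*\otimes\mathfrak{g}$ and $\Lambda^2\mathfrak{g}^*\otimes\mathfrak{g}$ respectively) and $dN_k|_\mu$ is the differential of the map $N_k$ at $\mu$. *)

(* Defs.v *)
From HB Require Import structures.
From mathcomp Require Import all_boot all_order all_algebra.
From mathcomp Require Import all_classical all_reals all_analysis.
Set Implicit Arguments.
Unset Strict Implicit.
Unset Printing Implicit Defensive.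
Import Order.TTheory GRing.Theory Num.Theory.
Import numFieldNormedType.Exports.
Local Open Scope classical_set_scope.
Local Open Scope ring_scope.

(* Quotient of a finite-dimensional vector space V by a subspace W, realised on
   the complement W^C; the class map is the projection onto W^C along W.  The
   lemmas below (surjective, with kernel W) characterise it as V -> V/W. *)
Notation quotv W := (subvs_of (W^C)%VS).

Section Quotient.
Context {K : fieldType} {V : vectType K}.
Implicit Types (W U : {vspace V}) (v : V).

Definition quot_class W : 'Hom(V, quotv W) :=
  (linfun (vsproj W^C) \o daddv_pi W^C W)%VF.

(* U / W, for a subspace W of U *)
Definition quot_vspace U W : {vspace quotv W} := (quot_class W @: U)%VS.

Lemma quot_classE W v : quot_class W v = vsproj W^C (daddv_pi W^C W v).
Proof. by rewrite /quot_class comp_lfunE lfunE. Qed.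

Lemma quot_class_eq0 W v : (quot_class W v == 0) = (v \in W).
Proof.
have capC0 : (W^C :&: W = 0)%VS by rewrite capvC capv_compl.
have addC v1 : v1 \in (W^C + W)%VS by rewrite addvC addv_complf memvf.
rewrite quot_classE; apply/eqP/idP => [/(congr1 vsval)|vW].
  rewrite vsprojK ?memv_pi// linear0 => h.
  by rewrite -(daddv_pi_add capC0 (addC v)) h add0r memv_pi.
suff -> : daddv_pi W^C W v = 0 by rewrite linear0.
have := daddv_pi_add capC0 (addC v).
by rewrite (daddv_pi_id (capv_compl W) vW) => /(canRL (addrK _)); rewrite subrr.
Qed.

Lemma lker_quot_class W : lker (quot_class W) = W.
Proof. by apply/vspaceP => v; rewrite memv_ker quot_class_eq0. Qed.

Lemma quot_class_surj W (q : quotv W) : exists v, quot_class W v = q.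
Proof.
exists (vsval q); rewrite quot_classE daddv_pi_id ?subvsP ?vsvalK//.
by rewrite capvC capv_compl.
Qed.

End Quotient.

(* The underlying vector space is R^n, with column vectors.  A p-linear map
   (R^n)^p -> R^n is encoded by the matrix whose columns are its values on the
   p-tuples of basis vectors: matrices carry both the vectType structure and
   the usual (normed) topology. *)
Notation vect R n := 'cV[R]_n.
Notation mlin R n p := 'M[R]_(n, #|{: p.-tuple 'I_n}|).

Section Multilinear.
Context {R : realType} {n : nat}.
Local Notation g := (vect R n).

Definition basis_vect (i : 'I_n) : g := delta_mx i 0.

Definition mapp p (f : mlin R n p) (x : p.-tuple g) : g :=
  \sum_(t : p.-tuple 'I_n)
    (\prod_(i < p) tnth x i (tnth t i) 0) *: col (enum_rank t) f.

Definition mlin_of p (F : p.-tuple g -> g) : mlin R n p :=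
  \matrix_(i, r) F (map_tuple basis_vect (enum_val r)) i 0.

Lemma mapp_basis p (f : mlin R n p) (t : p.-tuple 'I_n) :
  mapp f (map_tuple basis_vect t) = col (enum_rank t) f.
Proof.
rewrite /mapp (bigD1 t)//= [X in _ + X]big1 ?addr0 => [|s st].
  by rewrite big1 ?scale1r// => i _; rewrite tnth_map mxE !eqxx.
have [i sti] : exists i, tnth t i != tnth s i.
  apply/existsP; rewrite -negb_forall; apply: contra st => /forallP h.
  by apply/eqP/eq_from_tnth => i; rewrite (eqP (h i)).
rewrite (bigD1 i)//= tnth_map /basis_vect mxE eq_sym (negbTE sti) /=.
by rewrite mul0r scale0r.
Qed.

Lemma mappK p : cancel (@mapp p) (@mlin_of p).
Proof.
move=> f; apply/matrixP => i r.
by rewrite mxE mapp_basis enum_valK mxE.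
Qed.

End Multilinear.

Notation bil R n := (mlin R n 2).

Section LieStructures.
Context {R : realType} {n : nat}.
Local Notation g := (vect R n).
Implicit Types (s mu nu : bil R n) (x y z : g) (A f : 'M[R]_n).

Definition br s x y : g := mapp s [tuple x; y].

Lemma br_lin s y : linear (br s ^~ y).
Proof.
move=> a x x'; rewrite /br /mapp scaler_sumr -big_split; apply: eq_bigr => t _.
rewrite !big_ord_recl !big_ord0 !mulr1 !(tnth_nth 0) /=.
by rewrite !mxE mulrDl scalerDl -mulrA scalerA.
Qed.

Lemma br_linr s x : linear (br s x).
Proof.
move=> a y y'; rewrite /br /mapp scaler_sumr -big_split; apply: eq_bigr => t _.
rewrite !big_ord_recl !big_ord0 !mulr1 !(tnth_nth 0) /=.
by rewrite !mxE mulrDr scalerDl mulrCA scalerA.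
Qed.

Lemma br_linear x y : linear (fun s => br s x y).
Proof.
move=> a s s'; rewrite /br /mapp scaler_sumr -big_split; apply: eq_bigr => t _.
by rewrite linearP scalerDr !scalerA mulrC.
Qed.

Lemma br_basisE s x y : br s x y =
  \sum_i \sum_j (x i 0 * y j 0) *: br s (basis_vect i) (basis_vect j).
Proof.
pose fl (u : g) := GRing.isLinear.Build R g g _ _ (br_lin s u).
pose fr (u : g) := GRing.isLinear.Build R g g _ _ (br_linr s u).
pose Fl u : {linear g -> g} := HB.pack (br s ^~ u) (fl u).
pose Fr u : {linear g -> g} := HB.pack (br s u) (fr u).
have dec (u : g) : u = \sum_i u i 0 *: basis_vect i.
  rewrite {1}[u]matrix_sum_delta; apply: eq_bigr => i _.
  by rewrite big_ord1.
have bl u : br s x u = \sum_i x i 0 *: br s (basis_vect i) u.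
  rewrite {1}[x]dec -[LHS]/(Fl u _) linear_sum; apply: eq_bigr => i _.
  exact: linearZ.
have b_r u : br s u y = \sum_j y j 0 *: br s u (basis_vect j).
  rewrite {1}[y]dec -[LHS]/(Fr u _) linear_sum; apply: eq_bigr => j _.
  exact: linearZ.
rewrite bl; apply: eq_bigr => i _; rewrite b_r scaler_sumr.
by apply: eq_bigr => j _; rewrite scalerA.
Qed.

(* The defect of skew-symmetry; its kernel is Lambda^2 g^* (x) g. *)
Definition skew_defect s : mlin R n 2 :=
  mlin_of (fun X => br s (tnth X 0) (tnth X 1) + br s (tnth X 1) (tnth X 0)).

Definition alt2 : {vspace bil R n} := lker (linfun skew_defect).

Lemma mlin_of_basis p (F : p.-tuple g -> g) (t : p.-tuple 'I_n) :
  col (enum_rank t) (mlin_of F) = F (map_tuple basis_vect t).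
Proof. by apply/colP => i; rewrite !mxE enum_rankK. Qed.

Definition jac s x y z : g :=
  br s (br s x y) z + br s (br s y z) x + br s (br s z x) y.

(* N_k(s)(x_0, ..., x_k); the meaningful range is k >= 1 *)
Fixpoint Nk s k (x : nat -> g) : g :=
  if k is k'.+1 then br s (Nk s k' x) (x k) else x 0.

Definition Nk_mlin k s : mlin R n k.+1 :=
  mlin_of (fun X : k.+1.-tuple g => Nk s k (nth 0 X)).

Definition nilvar k : set (bil R n) :=
  [set s | [/\ s \in alt2,
               forall x y z, jac s x y z = 0 &
               forall X, Nk s k X = 0]].

Definition gl_act A mu : bil R n :=
  mlin_of (fun X => A *m br mu (invmx A *m tnth X 0) (invmx A *m tnth X 1)).

Definition orbit_gl mu : set (bil R n) :=
  [set gl_act A mu | A in [set A | A \in unitmx]].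

(* Open for the topology induced on the variety by the metric topology. *)
Definition rigid_nil k mu : Prop :=
  nilvar k mu /\
  exists2 U : set (bil R n), open U & orbit_gl mu = U `&` nilvar k.

(* Chevalley-Eilenberg differentials with adjoint coefficients; a 1-cochain
   is an endomorphism x |-> f *m x. *)
Definition d1 mu f : bil R n :=
  mlin_of (fun X => let x := tnth X 0 in let y := tnth X 1 in
    br mu x (f *m y) - br mu y (f *m x) - f *m br mu x y).

Definition d2 mu nu : mlin R n 3 :=
  mlin_of (fun X =>
    let x := tnth X 0 in let y := tnth X 1 in let z := tnth X 2%:R in
      br mu x (br nu y z) - br mu y (br nu x z) + br mu z (br nu x y)
    - br nu (br mu x y) z + br nu (br mu x z) y - br nu (br mu y z) x).

Lemma mlin_of_linear (W : lmodType R) p (F : W -> p.-tuple g -> g) :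
  (forall X, linear (F ^~ X)) -> linear (fun w => mlin_of (F w)).
Proof.
move=> linF a u v; apply/matrixP => i r.
by rewrite !mxE linF !mxE.
Qed.

Fact skew_defect_linear : linear skew_defect.
Proof.
apply: (@mlin_of_linear _ 2 (fun s X => _)) => X a s s' /=.
by rewrite !br_linear scalerDr addrACA.
Qed.
HB.instance Definition _ :=
  GRing.isLinear.Build R (bil R n) (mlin R n 2) _ skew_defect skew_defect_linear.

Lemma alt2P s : reflect (forall x y, br s x y = - br s y x) (s \in alt2).
Proof.
rewrite memv_ker lfunE; apply: (iffP eqP) => [s0 x y|sk]; last first.
  by apply/matrixP => i r; rewrite mxE sk addNr !mxE.
rewrite br_basisE [br s y x]br_basisE exchange_big -sumrN; apply: eq_bigr => j _.
rewrite -sumrN; apply: eq_bigr => i _; rewrite mulrC -scalerN; congr (_ *: _).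
have := mlin_of_basis (fun X => br s (tnth X 0) (tnth X 1) +
                                br s (tnth X 1) (tnth X 0)) [tuple i; j].
rewrite -/(skew_defect s) [skew_defect s]s0 !tnth_map /= => /esym/eqP.
by rewrite linear0 addr_eq0 => /eqP.
Qed.

Fact lin_comb (W : lmodType R) a (u v u' v' : W) :
  (a *: u + v) + (a *: u' + v') = a *: (u + u') + (v + v').
Proof. by rewrite scalerDr addrACA. Qed.

Fact lin_combB (W : lmodType R) a (u v u' v' : W) :
  (a *: u + v) - (a *: u' + v') = a *: (u - u') + (v - v').
Proof. by rewrite scalerBr opprD addrACA. Qed.

Fact d1_linear mu : linear (d1 mu).
Proof.
apply: (@mlin_of_linear _ 2 (fun f X => _)) => X a f f' /=.
by rewrite !mulmxDl -!scalemxAl !br_linr !(lin_comb, lin_combB).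
Qed.
HB.instance Definition _ mu :=
  GRing.isLinear.Build R 'M[R]_n (bil R n) _ (d1 mu) (d1_linear mu).

Fact d2_linear mu : linear (d2 mu).
Proof.
apply: (@mlin_of_linear _ 3 (fun nu X => _)) => X a nu nu' /=.
by rewrite !br_linear !br_linr !(lin_comb, lin_combB).
Qed.
HB.instance Definition _ mu :=
  GRing.isLinear.Build R (bil R n) (mlin R n 3) _ (d2 mu) (d2_linear mu).

(* Taken on the space of all bilinear maps; its restriction to alt2, as used in
   cocycles below, is the differential on Lambda^2 g^* (x) g. *)
Definition dNk k mu : {linear bil R n -> mlin R n k.+1} := 'd (Nk_mlin k) mu.

Definition cocycles k mu : {vspace bil R n} :=
  (alt2 :&: lker (linfun (d2 mu)) :&: lker (linfun (dNk k mu)))%VS.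

Definition coboundaries mu : {vspace bil R n} := limg (linfun (d1 mu)).

(* H^2_{k-nil}(g, g), as a subspace of the quotient of all bilinear maps by
   the coboundaries *)
Definition H2nil k mu : {vspace quotv (coboundaries mu)} :=
  quot_vspace (cocycles k mu) (coboundaries mu).

(* the skew-symmetric bilinear map with prescribed values on the pairs of
   basis vectors (e_i, e_j), i < j *)
Definition skew_of (c : nat -> nat -> g) : bil R n :=
  \matrix_(i, r) let t : 2.-tuple 'I_n := enum_val r in
    let p := tnth t 0 in let q := tnth t 1 in
    (if (p < q)%N then c p q else if (q < p)%N then - c q p else 0) i 0.

Lemma br_skew_of c (i j : 'I_n) : br (skew_of c) (basis_vect i) (basis_vect j) =
  if (i < j)%N then c i j else if (j < i)%N then - c j i else 0.
Proof.
rewrite /br.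
have -> : [tuple basis_vect i; basis_vect j] =
    map_tuple basis_vect [tuple i; j] :> 2.-tuple g by apply: val_inj.
by rewrite mapp_basis; apply/colP => k; rewrite !mxE enum_rankK.
Qed.

End LieStructures.

(* The basis a, b, c, d, e is numbered 0, 1, 2, 3, 4. *)
Section G53.
Context (R : realType).

Definition e5 (k : nat) : vect R 5 := basis_vect (inord k).

Definition g53 : bil R 5 := skew_of (fun i j =>
  match i, j with
  | 0%N, 1%N => e5 3
  | 0%N, 3%N => e5 4
  | 1%N, 2%N => e5 4
  | _, _ => 0
  end).

Definition nu1 : bil R 5 := skew_of (fun i j =>
  match i, j with
  | 1%N, 2%N => e5 2
  | _, _ => 0
  end).

Definition nu2 : bil R 5 := skew_of (fun i j =>
  match i, j with
  | 0%N, 1%N => e5 1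
  | 0%N, 2%N => - e5 2
  | 0%N, 3%N => - e5 3
  | _, _ => 0
  end).

End G53.

(* Main.v *)
Require Import Defs.
From HB Require Import structures.
From mathcomp Require Import all_boot all_order all_algebra.
From mathcomp Require Import all_classical all_reals all_analysis.
From mathcomp Require Import ring lra.

(** Write the brackets of a structure [s] as [[x, y]].

    Rigidity.  Let [s] be a 3-step nilpotent structure on the space of column
    vectors of size 5, let [a, b, c] be vectors and [phi] a linear form, and put
    [d = [a, b]], [e = [a, d]] and [omega x y = phi [x, y]].  Since [N_3 s = 0],
    [e] is central, so it lies in the radical of the alternating form [omega].
    If [phi e] and the Pfaffian of [omega] on [(a, b, c, d)] are both nonzero,
    then [(a, b, c, d, e)] is a basis and the centre is the line spanned by [e].
    All the iterated brackets [[[x, y], z]] are central, hence multiples of [e]: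
    this forces [[b, d]] and [[c, d]] to be multiples of [e], and [[a, c]] and
    [[b, c]] to be combinations of [d] and [e].  The Jacobi identity for
    [(a, b, c)] then leaves only structures that a triangular change of basis
    brings to the table of [g53] ([generic_orbit], [g53_frame_orbit]).  Both
    conditions say that one polynomial in [s], [generic_at], does not vanish; so
    the union of its nonvanishing loci over all [a, b, c, phi] is open, contains
    the orbit of [g53], and meets the variety in exactly that orbit
    ([g53_rigid]).

    Cohomology.  The Frechet derivative of [N_k] is computed once and for all in
    [dNkE], so the cocycle condition becomes an explicit system of linear
    equations ([cocyclesP]).  For [g53] it expresses 33 of the 50 coefficients
    of a skew-symmetric cochain by the 17 others ([cocycle_cf]).  Every solution
    is then the sum of an explicit coboundary and of a combination of [nu1] and
    [nu2] ([cocycle_decomp]), whose coefficients vanish when the combination is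
    itself a coboundary ([nu_coboundary]).  So the classes of [nu1] and [nu2]
    form a basis of [H2nil]. *)

Set Implicit Arguments.
Unset Strict Implicit.
Unset Printing Implicit Defensive.
Import Order.TTheory GRing.Theory Num.Theory.
Import numFieldNormedType.Exports.
Local Open Scope classical_set_scope.
Local Open Scope ring_scope.

(** * Bilinearity of the bracket *)

Section BracketCalculus.
Context {R : realType} {n : nat}.
Local Notation g := (vect R n).
Implicit Types (s t mu nu : bil R n) (x y z : g) (A f : 'M[R]_n).

Lemma brDl s x y z : br s (x + y) z = br s x z + br s y z.
Proof. by have := br_lin s z 1 x y; rewrite !scale1r. Qed.

Lemma brDr s x y z : br s x (y + z) = br s x y + br s x z.
Proof. by have := br_linr s x 1 y z; rewrite !scale1r. Qed.

Lemma br0l s y : br s 0 y = 0.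
Proof. by apply: (addrI (br s 0 y)); rewrite -brDl !addr0. Qed.

Lemma br0r s x : br s x 0 = 0.
Proof. by apply: (addrI (br s x 0)); rewrite -brDr !addr0. Qed.

Lemma brZl s a x y : br s (a *: x) y = a *: br s x y.
Proof. by have := br_lin s y a x 0; rewrite br0l !addr0. Qed.

Lemma brZr s a x y : br s x (a *: y) = a *: br s x y.
Proof. by have := br_linr s x a y 0; rewrite br0r !addr0. Qed.

Lemma brNl s x y : br s (- x) y = - br s x y.
Proof. by rewrite -scaleN1r brZl scaleN1r. Qed.

Lemma brNr s x y : br s x (- y) = - br s x y.
Proof. by rewrite -scaleN1r brZr scaleN1r. Qed.

Definition brE := (brDl, brDr, brZl, brZr, brNl, brNr, br0l, br0r).

Lemma br_skew s : s \in alt2 -> forall x y, br s x y = - br s y x.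
Proof. by move/alt2P. Qed.

Lemma br_alt s : s \in alt2 -> forall x, br s x x = 0.
Proof.
move=> sk x; have /eqP := br_skew sk x x.
by rewrite -addr_eq0 -mulr2n -scaler_nat scaler_eq0 pnatr_eq0 /= => /eqP.
Qed.

Lemma br_addl s t x y : br (s + t) x y = br s x y + br t x y.
Proof. by have := br_linear x y 1 s t; rewrite !scale1r. Qed.

Lemma br_scalel k s x y : br (k *: s) x y = k *: br s x y.
Proof.
have br0 : br (0 : bil R n) x y = 0.
  by apply: (addrI (br 0 x y)); rewrite -br_addl !addr0.
by have := br_linear x y k s 0; rewrite br0 !addr0.
Qed.

Lemma vect_dec x : x = \sum_i x i 0 *: basis_vect i.
Proof.
by rewrite {1}[x]matrix_sum_delta; apply: eq_bigr => i _; rewrite big_ord1.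
Qed.

Lemma bil_basisP s t :
  (forall i j, br s (basis_vect i) (basis_vect j) =
               br t (basis_vect i) (basis_vect j)) -> s = t.
Proof.
move=> st; apply: (can_inj (@mappK R n 2)); apply/funext => X.
have E u : mapp u X = br u (tnth X 0) (tnth X 1).
  congr mapp; apply: eq_from_tnth => i; rewrite [RHS](tnth_nth 0).
  by case: i => [[|[|//]] ?] /=; congr (tnth X _); apply: val_inj.
rewrite !E br_basisE [RHS]br_basisE.
by apply: eq_bigr => i _; apply: eq_bigr => j _; rewrite st.
Qed.

(** An operation given on all vectors is recovered from the matrix of its values
    on basis vectors, because it is bilinear.  This evaluates the structures
    that are defined by such a formula, [gl_act] and [d1]. *)
Lemma mlin_of_br (F : g -> g -> g) :
  (forall y, linear (F ^~ y)) -> (forall x, linear (F x)) ->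
  forall x y, br (mlin_of (fun X : 2.-tuple g => F (tnth X 0) (tnth X 1))) x y
    = F x y.
Proof.
move=> Fl Fr x y.
pose fl (u : g) := GRing.isLinear.Build R g g _ _ (Fl u).
pose fr (u : g) := GRing.isLinear.Build R g g _ _ (Fr u).
pose FL u : {linear g -> g} := HB.pack (F ^~ u) (fl u).
pose FR u : {linear g -> g} := HB.pack (F u) (fr u).
rewrite br_basisE [in RHS](vect_dec x) -[RHS]/(FL y _) linear_sum.
apply: eq_bigr => i _; rewrite linearZ /=.
rewrite [in RHS](vect_dec y) -[X in _ = _ *: X]/(FR _ _) linear_sum scaler_sumr.
apply: eq_bigr => j _; rewrite linearZ /= scalerA; congr (_ *: _).
rewrite /br.
have -> : [tuple basis_vect i; basis_vect j] =
    map_tuple basis_vect [tuple i; j] :> 2.-tuple g by apply: val_inj.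
by rewrite mapp_basis mlin_of_basis !tnth_map.
Qed.

Lemma skew_of_alt c : skew_of c \in @alt2 R n.
Proof.
apply/alt2P => x y; rewrite br_basisE [br _ y x]br_basisE exchange_big -sumrN.
apply: eq_bigr => j _; rewrite -sumrN; apply: eq_bigr => i _.
rewrite mulrC -scalerN !br_skew_of; congr (_ *: _).
by case: ltngtP; rewrite ?opprK ?oppr0.
Qed.

Lemma br_gl_act A mu x y :
  br (gl_act A mu) x y = A *m br mu (invmx A *m x) (invmx A *m y).
Proof.
rewrite (@mlin_of_br (fun x y => A *m br mu (invmx A *m x) (invmx A *m y))) //.
- by move=> v a u w; rewrite mulmxDr -scalemxAr !brE mulmxDr -scalemxAr.
- by move=> v a u w; rewrite mulmxDr -scalemxAr !brE mulmxDr -scalemxAr.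
Qed.

Lemma br_d1 mu f x y :
  br (d1 mu f) x y = br mu x (f *m y) - br mu y (f *m x) - f *m br mu x y.
Proof.
rewrite (@mlin_of_br (fun x y =>
  br mu x (f *m y) - br mu y (f *m x) - f *m br mu x y)) //.
- move=> v a u w; rewrite mulmxDr -scalemxAr !brE mulmxDr -scalemxAr.
  by rewrite !lin_combB.
- move=> v a u w; rewrite mulmxDr -scalemxAr !brE mulmxDr -scalemxAr.
  by rewrite !lin_combB.
Qed.

Lemma mlin_of_eq0 p (F : p.-tuple g -> g) :
  mlin_of F = 0 <-> forall t : p.-tuple 'I_n, F (map_tuple basis_vect t) = 0.
Proof.
split=> [F0 t|F0]; first by rewrite -mlin_of_basis F0 linear0.
by apply/matrixP => i r; rewrite !mxE F0 mxE.
Qed.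

Lemma Nk_ext s k (X Y : nat -> g) :
  (forall i, (i <= k)%N -> X i = Y i) -> Nk s k X = Nk s k Y.
Proof.
elim: k => [|k IH] XY /=; first exact: XY.
by rewrite IH ?XY// => i ik; apply/XY/leqW.
Qed.

(** The terms of [N_k (mu + nu)] of first order in [nu]. *)
Fixpoint Nk_lin mu nu k (X : nat -> g) : g :=
  if k is k'.+1 then br nu (Nk mu k' X) (X k) + br mu (Nk_lin mu nu k' X) (X k)
  else 0.

End BracketCalculus.

(** * The derivative of the iterated brackets *)

Section Differential.
Context {R : realType}.

Lemma is_diff_coord m n (M : 'M[R]_(m, n)) i j :
  is_diff M (fun N : 'M[R]_(m, n) => N i j : R) (fun N => N i j).
Proof.
apply: DiffDef; first exact: differentiable_coord.
have lin : linear (fun N : 'M[R]_(m, n) => N i j : R).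
  by move=> a u v; rewrite !mxE.
pose fM := GRing.isLinear.Build R 'M[R]_(m, n) R _ _ lin.
pose fL : {linear 'M[R]_(m, n) -> R} :=
  HB.pack (fun N : 'M[R]_(m, n) => N i j : R) fM.
by rewrite (@diff_lin _ _ _ fL) //; apply: coord_continuous.
Qed.

Lemma is_diff_sum (V W : normedModType R) (I : Type) (r : seq I)
    (f df : I -> V -> W) (x : V) :
  (forall i, is_diff x (f i) (df i)) ->
  is_diff x (fun y => \sum_(i <- r) f i y) (fun y => \sum_(i <- r) df i y).
Proof.
move=> fdf; elim: r => [|i r IH].
  have := is_diff_cst (0 : W) x.
  congr is_diff_def; apply/funext => y; by rewrite big_nil.
have := is_diffD (fdf i) IH.
by congr is_diff_def; apply/funext => y; rewrite big_cons.
Qed.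

Lemma is_diff_mx (V : normedModType R) m n (f df : 'I_m -> 'I_n -> V -> R) x :
  (forall i j, is_diff x (f i j) (df i j)) ->
  is_diff x (fun y => \matrix_(i, j) f i j y)
    (fun y => \matrix_(i, j) df i j y).
Proof.
move=> fdf.
have E (h : 'I_m -> 'I_n -> V -> R) : (fun y => \matrix_(i, j) h i j y) =
    (fun y => \sum_i \sum_j h i j y *: delta_mx i j).
  apply/funext => y; rewrite [LHS]matrix_sum_delta.
  by apply: eq_bigr => i _; apply: eq_bigr => j _; rewrite mxE.
rewrite !E; apply: is_diff_sum => i; apply: is_diff_sum => j.
have [dh hE] := fdf i j.
by apply: DiffDef; [exact: differentiableZl | rewrite diffZl // hE].
Qed.

(** The Leibniz rule for [s |-> br s (u s) y], which is quadratic in the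
    structure [s] as soon as [u] depends on it. *)
Lemma is_diff_br n (s0 : bil R n) (u du : bil R n -> vect R n) (y : vect R n) :
  is_diff s0 u du ->
  is_diff s0 (fun s => br s (u s) y) (fun s => br s (u s0) y + br s0 (du s) y).
Proof.
move=> dfu.
have ucoord i : is_diff s0 (fun s => u s i 0) (fun s => du s i 0).
  exact: (@is_diff_comp _ _ _ _ _ _ _ _ _ dfu (is_diff_coord (u s0) i 0)).
have brc s x z i : br s x z i 0 =
    \sum_(t : 2.-tuple 'I_n)
      (x (tnth t 0) 0 * z (tnth t 1) 0) * s i (enum_rank t).
  rewrite /br /mapp summxE; apply: eq_bigr => t _; rewrite !mxE.
  congr (_ * _).
  rewrite !big_ord_recl big_ord0 mulr1.
  by congr (x (tnth t _) 0 * z (tnth t _) 0); apply: val_inj.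
have E (h : bil R n -> vect R n) : h = (fun s => \matrix_(i, j) h s i j).
  by apply/funext => s; apply/matrixP => i j; rewrite mxE.
rewrite (E (fun s => br s (u s) y)).
rewrite (E (fun s => br s (u s0) y + br s0 (du s) y)).
apply: is_diff_mx => i j; rewrite (ord1 j) {j}.
have -> : (fun s => br s (u s) y i 0) = (fun s =>
    \sum_(t : 2.-tuple 'I_n)
      (u s (tnth t 0) 0 * y (tnth t 1) 0) * s i (enum_rank t)).
  by apply/funext => s; rewrite brc.
have -> : (fun s => (br s (u s0) y + br s0 (du s) y) i 0) = (fun s =>
    \sum_(t : 2.-tuple 'I_n) y (tnth t 1) 0 *
      (u s0 (tnth t 0) 0 * s i (enum_rank t)
       + s0 i (enum_rank t) * du s (tnth t 0) 0)).
  apply/funext => s; rewrite mxE !brc -big_split; apply: eq_bigr => t _ /=.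
  by ring.
apply: is_diff_sum => t.
have := is_diffZ (y (tnth t 1) 0)
  (is_diffM (ucoord (tnth t 0)) (is_diff_coord s0 i (enum_rank t))).
congr is_diff_def; apply/funext => s //=.
rewrite -[LHS]/(y (tnth t 1) 0 * (u s (tnth t 0) 0 * s i (enum_rank t))).
by rewrite mulrCA mulrA.
Qed.

Lemma is_diff_Nk n k (mu : bil R n) (X : nat -> vect R n) :
  is_diff mu (fun s => Nk s k X) (fun nu => Nk_lin mu nu k X).
Proof.
elim: k => [|k IH] /=; first exact: is_diff_cst.
exact: is_diff_br.
Qed.

Lemma dNkE n k (mu nu : bil R n) :
  dNk k mu nu = mlin_of (fun X : k.+1.-tuple _ => Nk_lin mu nu k (nth 0 X)).
Proof.
have dN : is_diff mu (@Nk_mlin R n k)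
    (fun nu => mlin_of (fun X : k.+1.-tuple _ => Nk_lin mu nu k (nth 0 X))).
  apply: is_diff_mx => i j.
  exact: (@is_diff_comp _ _ _ _ _ _ _ _ _ (is_diff_Nk _ _ _)
    (is_diff_coord _ _ _)).
by rewrite /dNk diff_val.
Qed.

Lemma continuous_Nk n k (phi : 'rV[R]_n) (X : nat -> vect R n) :
  continuous (fun s : bil R n => (phi *m Nk s k X) 0 0).
Proof.
move=> mu; apply: differentiable_continuous.
have -> : (fun s : bil R n => (phi *m Nk s k X) 0 0) =
    (fun s => \sum_i phi 0 i *: (Nk s k X i 0 : R)).
  by apply/funext => s; rewrite mxE.
have C i : is_diff mu (fun s => Nk s k X i 0) (fun nu => Nk_lin mu nu k X i 0).
  exact: (@is_diff_comp _ _ _ _ _ _ _ _ _ (is_diff_Nk _ _ _)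
    (is_diff_coord _ _ _)).
by have [] := is_diff_sum (index_enum _) (fun i => is_diffZ (phi 0 i) (C i)).
Qed.

End Differential.

(** * Cocycles, coboundaries and the action of the linear group *)

Section NilpotentVariety.
Context {R : realType} {n : nat}.
Local Notation g := (vect R n).
Implicit Types (s mu nu : bil R n) (x y z : g) (A f : 'M[R]_n).

Definition d2_at mu nu x y z : g :=
  br mu x (br nu y z) - br mu y (br nu x z) + br mu z (br nu x y)
  - br nu (br mu x y) z + br nu (br mu x z) y - br nu (br mu y z) x.

Lemma cocyclesP k mu nu :
  nu \in cocycles k mu <->
  [/\ nu \in alt2,
      forall i j l,
        d2_at mu nu (basis_vect i) (basis_vect j) (basis_vect l) = 0 &
      forall t : k.+1.-tuple 'I_n,
        Nk_lin mu nu k (nth 0 (map_tuple basis_vect t)) = 0].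
Proof.
rewrite !memv_cap !memv_ker !lfunE /= dNkE; split.
  move=> /andP[/andP[-> /eqP/mlin_of_eq0 d20] /eqP/mlin_of_eq0 dN0].
  split=> // i j l; have := d20 [tuple i; j; l].
  by rewrite !tnth_map.
move=> [-> d20 dN0] /=; apply/andP; split; apply/eqP/mlin_of_eq0 => // t.
by rewrite !tnth_map; apply: d20.
Qed.

Lemma d1_alt mu f : mu \in alt2 -> d1 mu f \in alt2.
Proof.
move=> sk; apply/alt2P => x y; rewrite !br_d1 (br_skew sk x y).
by rewrite mulmxN !opprD !opprK [X in X + _]addrC.
Qed.

(** [d2 o d1 = 0]: up to sign, [d2 (d1 f) (x, y, z)] is the sum of the Jacobi
    expressions of [(f x, y, z)], [(x, f y, z)] and [(x, y, f z)], minus [f]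
    applied to that of [(x, y, z)]. *)
Lemma d2_at_d1 mu f x y z : mu \in alt2 ->
  (forall x y z, jac mu x y z = 0) -> d2_at mu (d1 mu f) x y z = 0.
Proof.
move=> sk jac0; rewrite /d2_at !br_d1 !brE.
have Jx := jac0 y z (f *m x); have Jy := jac0 z x (f *m y).
have Jz := jac0 x y (f *m z).
have Jf : f *m jac mu x y z = 0 by rewrite jac0 mulmx0.
(* every double bracket is written with the inner one on the left *)
move: Jx Jy Jz Jf; rewrite /jac !mulmxDr.
rewrite (br_skew sk x (br mu y _)) (br_skew sk x (br mu z _)).
rewrite (br_skew sk y (br mu x _)) (br_skew sk y (br mu z _)).
rewrite (br_skew sk z (br mu x _)) (br_skew sk z (br mu y _)).
rewrite (br_skew sk (f *m x) y) (br_skew sk (f *m y) z) (br_skew sk (f *m z) x).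
rewrite (br_skew sk z x) !brE !mulmxN.
do ?[match goal with |- context [br ?s ?u ?v] => move: (br s u v) => ? end].
do ?[match goal with |- context [?s *m ?u] => move: (s *m u) => ? end].
move=> /colP Jx /colP Jy /colP Jz /colP Jf; apply/colP => i.
by move: (Jx i) (Jy i) (Jz i) (Jf i); rewrite !mxE; lra.
Qed.

(** [d1 mu f] is the derivative of the structures conjugate to [mu] under
    [1 - t f], so [N_k] varies along it by the infinitesimal action of [f] on
    multilinear maps. *)
Lemma Nk_lin_d1 mu f k X : mu \in alt2 ->
  Nk_lin mu (d1 mu f) k X =
  \sum_(j < k.+1) Nk mu k (fun i => if i == j then f *m X i else X i)
  - f *m Nk mu k X.
Proof.
move=> sk; elim: k => [|k IH] /=; first by rewrite big_ord1 subrr.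
rewrite IH br_d1 (br_skew sk (X _) (f *m _)) opprK.
rewrite [in RHS]big_ord_recr /= eqxx.
rewrite (@Nk_ext _ _ mu k _ X); last by move=> i ik; rewrite ltn_eqF.
have -> : \sum_(i < k.+1) br mu
    (Nk mu k (fun j => if j == i then f *m X j else X j))
    (if k.+1 == i then f *m X k.+1 else X k.+1) =
  br mu (\sum_(i < k.+1) Nk mu k (fun j => if j == i then f *m X j else X j))
    (X k.+1).
  elim/big_ind2: _ => [|u u' v v' -> ->|i _]; rewrite ?br0l ?brDl//.
  by rewrite gtn_eqF // ltn_ord.
rewrite brDl brNl; move: (br _ (\sum_(_ < _) _) _) (br _ _ (f *m _)) => S a.
move: (br _ (f *m _) _) => b; move: (f *m _) => c.
by apply/colP => i; rewrite !mxE; ring.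
Qed.

Lemma coboundaries_sub k mu : nilvar k mu ->
  (coboundaries mu <= cocycles k mu)%VS.
Proof.
move=> [sk jac0 Nk0]; apply/subvP => _ /memv_imgP[f _ ->]; rewrite lfunE /=.
apply/cocyclesP; split=> [|i j l|t]; first exact: d1_alt.
  exact: d2_at_d1.
by rewrite Nk_lin_d1 // Nk0 mulmx0 subr0 big1.
Qed.

Lemma gl_act_nilvar k A mu : A \in unitmx -> nilvar k mu ->
  nilvar k (gl_act A mu).
Proof.
move=> uA [sk jac0 Nk0]; split.
- by apply/alt2P => x y; rewrite !br_gl_act (br_skew sk) mulmxN.
- move=> x y z; rewrite /jac !br_gl_act !mulKmx // -!mulmxDr.
  by rewrite -/(jac _ _ _ _) jac0 mulmx0.
move=> X.
have -> : Nk (gl_act A mu) k X = A *m Nk mu k (fun i => invmx A *m X i).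
  elim: k {Nk0} => [|k IH] /=; first by rewrite mulKVmx.
  by rewrite IH br_gl_act mulKmx.
by rewrite Nk0 mulmx0.
Qed.

End NilpotentVariety.

(** * Coordinates in dimension five *)

Section Coordinates.
Context {R : realType}.
Local Notation g := (vect R 5).
Implicit Types (x y : g).

Lemma big_ord5 (V : nmodType) (F : 'I_5 -> V) :
  \sum_(i < 5) F i =
  F (inord 0) + F (inord 1) + F (inord 2) + F (inord 3) + F (inord 4).
Proof.
rewrite !big_ord_recl big_ord0 addr0 !addrA.
by congr (_ + _ + _ + _ + _); congr F; apply: val_inj; rewrite /= inordK.
Qed.

(** Coordinates indexed by [nat], so that they compute on numerals. *)
Definition co x k : R := x (inord k) 0.

Definition of_co (l : seq R) : g := \col_i l`_i.

Lemma co_of_co l k : (k < 5)%N -> co (of_co l) k = l`_k.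
Proof. by move=> k5; rewrite /co mxE inordK. Qed.

Lemma coD x y k : co (x + y) k = co x k + co y k.
Proof. by rewrite /co mxE. Qed.

Lemma coZ a x k : co (a *: x) k = a * co x k.
Proof. by rewrite /co mxE. Qed.

Lemma coN x k : co (- x) k = - co x k.
Proof. by rewrite /co mxE. Qed.

Lemma co0 k : co (0 : g) k = 0.
Proof. by rewrite /co mxE. Qed.

Lemma co_inj x y : (forall k, (k < 5)%N -> co x k = co y k) -> x = y.
Proof.
by move=> xy; apply/colP => i; have := xy i (ltn_ord i); rewrite /co inord_val.
Qed.

Lemma co_e5 j k : (j < 5)%N -> (k < 5)%N -> co (e5 R j) k = (k == j)%:R.
Proof.
move=> j5 k5; rewrite /co /e5 /basis_vect mxE eqxx andbT.
by congr (nat_of_bool _)%:R; rewrite -val_eqE /= !inordK.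
Qed.

Lemma e5_tr_mul k x : (k < 5)%N -> ((e5 R k)^T *m x) 0 0 = co x k.
Proof. by move=> k5; rewrite /e5 /basis_vect trmx_delta -rowE mxE. Qed.

End Coordinates.

(** * The structure g53 and the cochains nu1, nu2 *)

Section Structures.
Context {R : realType}.
Local Notation g := (vect R 5).
Implicit Types (x y z : g).

Lemma br_g53E x y : br (g53 R) x y =
  (co x 0 * co y 1 - co x 1 * co y 0) *: e5 R 3 +
  (co x 0 * co y 3 - co x 3 * co y 0 + co x 1 * co y 2 - co x 2 * co y 1)
    *: e5 R 4.
Proof.
rewrite br_basisE !big_ord5 !br_skew_of !inordK //= /co.
move: (e5 R 3) (e5 R 4) => e3 e4.
by apply/colP => i; rewrite !mxE; ring.
Qed.

Lemma co_br_g53 x y :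
  ((co (br (g53 R) x y) 0 = 0) * (co (br (g53 R) x y) 1 = 0) *
   (co (br (g53 R) x y) 2 = 0) *
   (co (br (g53 R) x y) 3 = co x 0 * co y 1 - co x 1 * co y 0) *
   (co (br (g53 R) x y) 4 = co x 0 * co y 3 - co x 3 * co y 0
                           + co x 1 * co y 2 - co x 2 * co y 1))%type.
Proof. by rewrite br_g53E !(coD, coZ) !co_e5 //=; do !split; ring. Qed.

Lemma br_g53_e5 :
  ((br (g53 R) (e5 R 0) (e5 R 0) = 0) *
   (br (g53 R) (e5 R 0) (e5 R 1) = e5 R 3) *
   (br (g53 R) (e5 R 0) (e5 R 2) = 0) *
   (br (g53 R) (e5 R 0) (e5 R 3) = e5 R 4) *
   (br (g53 R) (e5 R 0) (e5 R 4) = 0) *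
   (br (g53 R) (e5 R 1) (e5 R 0) = - e5 R 3) *
   (br (g53 R) (e5 R 1) (e5 R 1) = 0) *
   (br (g53 R) (e5 R 1) (e5 R 2) = e5 R 4) *
   (br (g53 R) (e5 R 1) (e5 R 3) = 0) *
   (br (g53 R) (e5 R 1) (e5 R 4) = 0) *
   (br (g53 R) (e5 R 2) (e5 R 0) = 0) *
   (br (g53 R) (e5 R 2) (e5 R 1) = - e5 R 4) *
   (br (g53 R) (e5 R 2) (e5 R 2) = 0) *
   (br (g53 R) (e5 R 2) (e5 R 3) = 0) *
   (br (g53 R) (e5 R 2) (e5 R 4) = 0) *
   (br (g53 R) (e5 R 3) (e5 R 0) = - e5 R 4) *
   (br (g53 R) (e5 R 3) (e5 R 1) = 0) *
   (br (g53 R) (e5 R 3) (e5 R 2) = 0) *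
   (br (g53 R) (e5 R 3) (e5 R 3) = 0) *
   (br (g53 R) (e5 R 3) (e5 R 4) = 0) *
   (br (g53 R) (e5 R 4) (e5 R 0) = 0) *
   (br (g53 R) (e5 R 4) (e5 R 1) = 0) *
   (br (g53 R) (e5 R 4) (e5 R 2) = 0) *
   (br (g53 R) (e5 R 4) (e5 R 3) = 0) *
   (br (g53 R) (e5 R 4) (e5 R 4) = 0))%type.
Proof.
do !split; rewrite br_g53E !co_e5 //=;
  rewrite !(mul0r, mulr0, mulr1, subr0, sub0r, addr0, add0r, oppr0);
  by rewrite ?scaleN1r ?scale1r !scale0r ?addr0 ?add0r.
Qed.

Lemma br_nu1E x y : br (nu1 R) x y =
  (co x 1 * co y 2 - co x 2 * co y 1) *: e5 R 2.
Proof.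
rewrite br_basisE !big_ord5 !br_skew_of !inordK //= /co.
move: (e5 R 2) => e2.
by apply/colP => i; rewrite !mxE; ring.
Qed.

Lemma co_br_nu1 x y :
  ((co (br (nu1 R) x y) 0 = 0) * (co (br (nu1 R) x y) 1 = 0) *
   (co (br (nu1 R) x y) 2 = co x 1 * co y 2 - co x 2 * co y 1) *
   (co (br (nu1 R) x y) 3 = 0) * (co (br (nu1 R) x y) 4 = 0))%type.
Proof. by rewrite br_nu1E !(coD, coZ) !co_e5 //=; do !split; ring. Qed.

Lemma br_nu2E x y : br (nu2 R) x y =
  (co x 0 * co y 1 - co x 1 * co y 0) *: e5 R 1 -
  (co x 0 * co y 2 - co x 2 * co y 0) *: e5 R 2 -
  (co x 0 * co y 3 - co x 3 * co y 0) *: e5 R 3.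
Proof.
rewrite br_basisE !big_ord5 !br_skew_of !inordK //= /co.
move: (e5 R 1) (e5 R 2) (e5 R 3) => e1 e2 e3.
by apply/colP => i; rewrite !mxE; ring.
Qed.

Lemma co_br_nu2 x y :
  ((co (br (nu2 R) x y) 0 = 0) *
   (co (br (nu2 R) x y) 1 = co x 0 * co y 1 - co x 1 * co y 0) *
   (co (br (nu2 R) x y) 2 = co x 2 * co y 0 - co x 0 * co y 2) *
   (co (br (nu2 R) x y) 3 = co x 3 * co y 0 - co x 0 * co y 3) *
   (co (br (nu2 R) x y) 4 = 0))%type.
Proof. by rewrite br_nu2E !(coD, coN, coZ) !co_e5 //=; do !split; ring. Qed.

Lemma g53_nilvar : nilvar 3 (g53 R).
Proof.
split=> [|x y z|X]; first exact: skew_of_alt.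
  (* [g53] is made abstract so that rewriting does not unfold it *)
  have M := co_br_g53; move: (g53 R) M => mu M.
  apply: co_inj; case=> [|[|[|[|[|//]]]]] _;
    by rewrite /jac !(coD, M) ?co0; ring.
have M := co_br_g53; move: (g53 R) M => mu M /=.
by apply: co_inj; case=> [|[|[|[|[|//]]]]] _; rewrite !M ?co0; ring.
Qed.

End Structures.

(** * Bases adapted to g53 *)

Section Frames.
Context {R : realType}.
Local Notation g := (vect R 5).
Implicit Types (s : bil R 5) (x y z : g) (v : nat -> g).

Definition frame v : 'M[R]_5 := \matrix_(i, j) v j i 0.

Lemma frame_mul v x : frame v *m x =
  co x 0 *: v 0 + co x 1 *: v 1 + co x 2 *: v 2 + co x 3 *: v 3 + co x 4 *: v 4.
Proof.
apply/colP => i; rewrite mxE big_ord5 !mxE !inordK //.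
by rewrite /co; ring.
Qed.

Lemma frame_e5 v k : (k < 5)%N -> frame v *m e5 R k = v k.
Proof.
move=> k5; rewrite frame_mul !co_e5 //.
case: k k5 => [|[|[|[|[|//]]]]] _ /=;
  by rewrite !scale0r scale1r ?addr0 ?add0r.
Qed.

Lemma frame_unit v :
  (forall x0 x1 x2 x3 x4 : R,
     x0 *: v 0 + x1 *: v 1 + x2 *: v 2 + x3 *: v 3 + x4 *: v 4 = 0 ->
     [/\ x0 = 0, x1 = 0, x2 = 0, x3 = 0 & x4 = 0]) ->
  frame v \in unitmx.
Proof.
move=> vfree; rewrite -unitmx_tr -row_free_unit; apply: inj_row_free => u u0.
have : frame v *m u^T = 0 by rewrite -[frame v]trmxK -trmx_mul u0 trmx0.
rewrite frame_mul => /vfree[]; rewrite /co !mxE => x0 x1 x2 x3 x4.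
apply/rowP => i; rewrite mxE -(inord_val i).
by case: i => [[|[|[|[|[|//]]]]] ?] /=.
Qed.

Lemma frame_dec v : frame v \in unitmx -> forall w, exists x : g, w =
  co x 0 *: v 0 + co x 1 *: v 1 + co x 2 *: v 2 + co x 3 *: v 3 + co x 4 *: v 4.
Proof.
by move=> uv w; exists (invmx (frame v) *m w); rewrite -frame_mul mulKVmx.
Qed.

(** Bracketing a linear relation between the [v i] with [v 3], [v 2], [v 1] and
    [v 0] kills its coefficients one after the other, so [v] is a basis, which
    carries the table of [g53] to [s]. *)
Lemma g53_frame_orbit s v : s \in alt2 -> v 4 != 0 ->
  (forall x, br s (v 4) x = 0) ->
  br s (v 0) (v 1) = v 3 -> br s (v 0) (v 3) = v 4 -> br s (v 1) (v 2) = v 4 ->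
  br s (v 0) (v 2) = 0 -> br s (v 1) (v 3) = 0 -> br s (v 2) (v 3) = 0 ->
  orbit_gl (g53 R) s.
Proof.
move=> sk v4n0 c4 b01 b03 b12 b02 b13 b23.
have c4r x : br s x (v 4) = 0 by rewrite br_skew // c4 oppr0.
have b10 : br s (v 1) (v 0) = - v 3 by rewrite br_skew // b01.
have b30 : br s (v 3) (v 0) = - v 4 by rewrite br_skew // b03.
have b21 : br s (v 2) (v 1) = - v 4 by rewrite br_skew // b12.
have b20 : br s (v 2) (v 0) = 0 by rewrite br_skew // b02 oppr0.
have b31 : br s (v 3) (v 1) = 0 by rewrite br_skew // b13 oppr0.
have b32 : br s (v 3) (v 2) = 0 by rewrite br_skew // b23 oppr0.
pose T := (c4, c4r, b01, b03, b12, b02, b13, b23, b10, b30, b21, b20, b31, b32,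
           br_alt sk).
have uv : frame v \in unitmx.
  apply: frame_unit => x0 x1 x2 x3 x4 x_eq0.
  have scal0 a : a *: v 4 = 0 -> a = 0.
    by move/eqP; rewrite scaler_eq0 (negbTE v4n0) orbF => /eqP.
  have E w : x0 *: br s (v 0) w + x1 *: br s (v 1) w + x2 *: br s (v 2) w +
      x3 *: br s (v 3) w + x4 *: br s (v 4) w = 0.
    by rewrite -!brZl -!brDl x_eq0 br0l.
  have {}x0E : x0 = 0.
    by apply: scal0; have := E (v 3); rewrite !T !scaler0 !addr0.
  have {}x1E : x1 = 0.
    by apply: scal0; have := E (v 2); rewrite !T !scaler0 !addr0 add0r.
  have {}x2E : x2 = 0.
    apply: scal0; have := E (v 1).
    rewrite !T x0E scale0r !scaler0 !addr0 !add0r scalerN => /eqP.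
    by rewrite oppr_eq0 => /eqP.
  have {}x3E : x3 = 0.
    apply: scal0; have := E (v 0).
    rewrite !T x1E scale0r !scaler0 !addr0 !add0r scalerN => /eqP.
    by rewrite oppr_eq0 => /eqP.
  split=> //; apply: scal0; move: x_eq0.
  by rewrite x0E x1E x2E x3E !scale0r !add0r.
exists (frame v) => //.
apply: bil_basisP => i j; rewrite br_gl_act br_g53E.
rewrite mulmxDr -!scalemxAr !frame_e5 //.
rewrite -[in RHS](mulKVmx uv (basis_vect i)).
rewrite -[in RHS](mulKVmx uv (basis_vect j)).
move: (invmx _ *m basis_vect i) (invmx _ *m basis_vect j) => x y.
rewrite !frame_mul !brE !T; move: (v 3) (v 4) => v3 v4.
by apply/colP => k; rewrite !mxE; ring.
Qed.

End Frames.

(** * Rigidity *)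

Section Rigidity.
Context {R : realType}.
Local Notation g := (vect R 5).
Implicit Types (s : bil R 5) (x y z a b c : g) (phi : 'rV[R]_5).

Definition val_at phi x : R := (phi *m x) 0 0.

Lemma val_atD phi x y : val_at phi (x + y) = val_at phi x + val_at phi y.
Proof. by rewrite /val_at mulmxDr mxE. Qed.

Lemma val_atZ phi k x : val_at phi (k *: x) = k * val_at phi x.
Proof. by rewrite /val_at -scalemxAr mxE. Qed.

Lemma val_atN phi x : val_at phi (- x) = - val_at phi x.
Proof. by rewrite /val_at mulmxN mxE. Qed.

(** With [d = [a, b]], this is the value of [phi] at [[a, d]] times the Pfaffian
    of [(x, y) |-> phi [x, y]] on [(a, b, c, d)]. *)
Definition generic_at phi a b c s : R :=
  let n1 x y := val_at phi (br s x y) in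
  let n2 x := val_at phi (br s (br s a b) x) in
  n2 a * (n1 a b * n2 c - n1 a c * n2 b + n2 a * n1 b c).

Lemma continuous_generic_at phi a b c : continuous (generic_at phi a b c).
Proof.
have C1 x y : continuous (fun s => val_at phi (br s x y)).
  by move=> t; exact: (@continuous_Nk R 5 1 phi (nth 0 [:: x; y]) t).
have C2 x : continuous (fun s => val_at phi (br s (br s a b) x)).
  by move=> t; exact: (@continuous_Nk R 5 2 phi (nth 0 [:: a; b; x]) t).
move=> s; apply: (cvgM (C2 a s)).
apply: cvgD (cvgM (C2 a s) (C1 b c s)).
exact: (cvgB (cvgM (C1 a b s) (C2 c s)) (cvgM (C1 a c s) (C2 b s))).
Qed.

Section Classification.
Context (phi : 'rV[R]_5) (a b c : g) (s : bil R 5).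
Context (s3 : nilvar 3 s) (gen : generic_at phi a b c s != 0).

Let sk : s \in alt2. Proof. by case: s3. Qed.
Let d := br s a b.
Let e := br s a d.
Let omega x y := val_at phi (br s x y).
Let comb x :=
  co x 0 *: a + co x 1 *: b + co x 2 *: c + co x 3 *: d + co x 4 *: e.

Lemma N3_eq0 x y z w : br s (br s (br s x y) z) w = 0.
Proof. by case: s3 => _ _ /(_ (nth 0 [:: x; y; z; w])). Qed.

Lemma e_central x : br s e x = 0.
Proof. by rewrite /e (br_skew sk a) brNl N3_eq0 oppr0. Qed.

Lemma omega_skew x y : omega x y = - omega y x.
Proof. by rewrite /omega (br_skew sk) val_atN. Qed.

Lemma omega_alt x : omega x x = 0.
Proof. by rewrite /omega (br_alt sk) /val_at mulmx0 mxE. Qed.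

Lemma pf_neq0 :
  omega a b * omega c d - omega a c * omega b d + omega a d * omega b c != 0.
Proof.
move: gen; rewrite /generic_at mulf_eq0 negb_or => /andP[_].
rewrite -/d -!/(omega _ _) !(omega_skew d) -oppr_eq0; apply: contraNN => /eqP h.
by apply/eqP; rewrite -h; ring.
Qed.

Lemma omega_ad_neq0 : omega a d != 0.
Proof.
move: gen; rewrite /generic_at mulf_eq0 negb_or => /andP[h _]; move: h.
by rewrite -/d -/(omega _ _) (omega_skew d) oppr_eq0.
Qed.

(** [omega] is nondegenerate on [(a, b, c, d)], and a central vector is in its
    radical. *)
Lemma radical_comb x : (forall y, br s (comb x) y = 0) ->
  [/\ co x 0 = 0, co x 1 = 0, co x 2 = 0 & co x 3 = 0].
Proof.
move=> xc.
have E y : co x 0 * omega a y + co x 1 * omega b y + co x 2 * omega c y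
    + co x 3 * omega d y = 0.
  have : val_at phi (br s (comb x) y) = 0 by rewrite xc /val_at mulmx0 mxE.
  by rewrite !brE e_central scaler0 addr0 !(val_atD, val_atZ).
have := pf_neq0; move: (E a) (E b) (E c) (E d); rewrite !omega_alt.
rewrite (omega_skew b a) (omega_skew c a) (omega_skew d a).
rewrite (omega_skew c b) (omega_skew d b) (omega_skew d c).
move: (omega a b) (omega a c) (omega a d) => ab ac ad.
move: (omega b c) (omega b d) (omega c d) => bc bd cd.
move: (co x 0) (co x 1) (co x 2) (co x 3) => x0 x1 x2 x3.
set pf := (X in X != 0) => Ea Eb Ec Ed pf0.
have cancel (k : R) : pf * k = 0 -> k = 0.
  by move/eqP; rewrite mulf_eq0 (negbTE pf0) => /eqP.
(* The coefficients are, up to sign, the rows of the Pfaffian adjoint of the Gram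
   matrix, which is the Pfaffian times the inverse. *)
split; apply: cancel; rewrite /pf.
- by move: (congr1 ( *%R cd) Eb) (congr1 ( *%R bd) Ec) (congr1 ( *%R bc) Ed);
    rewrite !mulr0; lra.
- by move: (congr1 ( *%R cd) Ea) (congr1 ( *%R ad) Ec) (congr1 ( *%R ac) Ed);
    rewrite !mulr0; lra.
- by move: (congr1 ( *%R bd) Ea) (congr1 ( *%R ad) Eb) (congr1 ( *%R ab) Ed);
    rewrite !mulr0; lra.
- by move: (congr1 ( *%R bc) Ea) (congr1 ( *%R ac) Eb) (congr1 ( *%R ab) Ec);
    rewrite !mulr0; lra.
Qed.

Lemma e_neq0 : e != 0.
Proof.
apply: contraNneq omega_ad_neq0 => e0.
by rewrite /omega -/e e0 /val_at mulmx0 mxE.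
Qed.

Lemma comb_central (x0 x1 x2 x3 x4 : R) :
  (forall y, br s (x0 *: a + x1 *: b + x2 *: c + x3 *: d + x4 *: e) y = 0) ->
  [/\ x0 = 0, x1 = 0, x2 = 0 & x3 = 0].
Proof.
pose x : g := of_co [:: x0; x1; x2; x3; x4].
have coE k : (k < 5)%N -> co x k = nth 0 [:: x0; x1; x2; x3; x4] k.
  exact: co_of_co.
by have := @radical_comb x; rewrite /comb !coE.
Qed.

Lemma comb_ex w : exists x, w = comb x.
Proof.
pose v := nth 0 [:: a; b; c; d; e].
suff uv : frame v \in unitmx by exact: (frame_dec uv).
apply: frame_unit => x0 x1 x2 x3 x4 /= x_eq0.
have [y|x00 x10 x20 x30] := @comb_central x0 x1 x2 x3 x4.
  by rewrite x_eq0 br0l.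
split=> //; apply/eqP; move: x_eq0; rewrite x00 x10 x20 x30 !scale0r !add0r.
by move/eqP; rewrite scaler_eq0 (negbTE e_neq0) orbF.
Qed.

Lemma central_e w : (forall y, br s w y = 0) -> exists k, w = k *: e.
Proof.
move=> wc; have [x xE] := comb_ex w.
have [|x0 x1 x2 x3] := @radical_comb x; first by rewrite -xE.
by exists (co x 4); rewrite xE /comb x0 x1 x2 x3 !scale0r !add0r.
Qed.

Let e_centralr x : br s x e = 0.
Proof. by rewrite (br_skew sk) e_central oppr0. Qed.

Let bb_central x y z w : br s (br s x (br s y z)) w = 0.
Proof. by rewrite (br_skew sk x) brNl N3_eq0 oppr0. Qed.

Lemma bd_ex : exists v, br s b d = v *: e.
Proof. by apply: central_e => y; rewrite /d bb_central. Qed.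

Lemma cd_ex : exists w, br s c d = w *: e.
Proof. by apply: central_e => y; rewrite /d bb_central. Qed.

Let sq0 (r : R) : r * r = 0 -> r = 0.
Proof. by move/eqP; rewrite mulf_eq0 orbb => /eqP. Qed.

(** In the two lemmas below, [r] vanishes because its square is the
    [c]-coordinate of a central vector; the other coordinates follow in turn. *)
Lemma ac_ex : exists t t', br s a c = t *: d + t' *: e.
Proof.
have [x acE] := comb_ex (br s a c); move: acE; rewrite /comb.
move: (co x 0) (co x 1) (co x 2) (co x 3) (co x 4) => p q r t t' acE.
have [v bdE] := bd_ex.
have [] := @comb_central (r * p) (r * q) (r * r) (q + r * t) (r * t' + t).
  move=> y; rewrite -(bb_central a a c y); congr (br s _ y).
  rewrite acE !brE (br_alt sk) -/d -/e e_centralr acE.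
  by move: (d) (e) => d0 e0; apply/colP => i; rewrite !mxE; ring.
move=> _ _ /sq0 r0; rewrite r0 mul0r addr0 => q0.
have [] := @comb_central 0 0 0 (- p) (t * v).
  move=> y; rewrite -(bb_central b a c y); congr (br s _ y).
  rewrite acE r0 q0 !brE (br_skew sk b a) -/d bdE e_centralr.
  by move: (d) (e) => d0 e0; apply/colP => i; rewrite !mxE; ring.
move=> _ _ _ /eqP; rewrite oppr_eq0 => /eqP p0.
by exists t, t'; rewrite acE p0 q0 r0 !scale0r !add0r.
Qed.

Lemma bc_ex : exists u u', br s b c = u *: d + u' *: e.
Proof.
have [x bcE] := comb_ex (br s b c); move: bcE; rewrite /comb.
move: (co x 0) (co x 1) (co x 2) (co x 3) (co x 4) => p q r u u' bcE.
have [v bdE] := bd_ex; have [t [t' acE]] := ac_ex.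
have [] := @comb_central (r * p) (r * q) (r * r) (r * u - p) (r * u' + u * v).
  move=> y; rewrite -(bb_central b b c y); congr (br s _ y).
  rewrite bcE !brE (br_alt sk) (br_skew sk b a) -/d bdE e_centralr bcE.
  by move: (d) (e) => d0 e0; apply/colP => i; rewrite !mxE; ring.
move=> _ _ /sq0 r0; rewrite r0 mul0r sub0r => /eqP; rewrite oppr_eq0 => /eqP p0.
have [] := @comb_central 0 0 0 q u.
  move=> y; rewrite -(bb_central a b c y); congr (br s _ y).
  rewrite bcE r0 p0 !brE (br_alt sk) -/d -/e e_centralr.
  by move: (d) (e) => d0 e0; apply/colP => i; rewrite !mxE; ring.
move=> _ _ _ q0.
by exists u, u'; rewrite bcE p0 q0 r0 !scale0r !add0r.
Qed.

Lemma generic_orbit : orbit_gl (g53 R) s.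
Proof.
have [v bdE] := bd_ex; have [w cdE] := cd_ex.
have [t [t' acE]] := ac_ex; have [u [u' bcE]] := bc_ex.
have abE : br s a b = d by []. have adE : br s a d = e by [].
have baE : br s b a = - d by rewrite (br_skew sk).
have daE : br s d a = - e by rewrite (br_skew sk).
have caE : br s c a = - (t *: d + t' *: e) by rewrite (br_skew sk) acE.
have cbE : br s c b = - (u *: d + u' *: e) by rewrite (br_skew sk) bcE.
have dbE : br s d b = - (v *: e) by rewrite (br_skew sk) bdE.
have dcE : br s d c = - (w *: e) by rewrite (br_skew sk) cdE.
pose T := (abE, adE, baE, daE, acE, caE, bcE, cbE, bdE, dbE, cdE, dcE,
  e_central, e_centralr, br_alt sk).
have uE : u = t * v - w.
  have jac0 : jac s a b c = 0 by case: s3.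
  have : (t * v - w - u) *: e = 0.
    rewrite -jac0 /jac !(T, brE).
    by move: (d) (e) => d0 e0; apply/colP => i; rewrite !mxE; ring.
  move/eqP; rewrite scaler_eq0 (negbTE e_neq0) orbF => /eqP; lra.
pose m := u' - t' * v.
have m0 : m != 0.
  apply: contraNneq pf_neq0 => m0.
  rewrite /omega !T !(val_atD, val_atZ) uE.
  have -> : u' = t' * v by rewrite -[LHS](subrK (t' * v)) -/m m0 add0r.
  by apply/eqP; ring.
(* [b] and [c] are corrected by multiples of [a], [b] and [d] to commute with
   [d], then [c] to commute with [a]; [m] is what remains of [[b, c]]. *)
pose f : nat -> g := nth 0 [:: a; b - v *: a;
  m^-1 *: (c - w *: a - t *: (b - v *: a) - t' *: d); d; e].
apply: (@g53_frame_orbit _ s f) => //=; rewrite ?e_neq0 //.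
- exact: e_central.
- by rewrite /f /= !(T, brE) scaler0 subr0.
- rewrite /f /= !(T, brE).
  move: (d) (e) => d0 e0; apply/colP => i; rewrite !mxE uE /m; field.
  exact: m0.
- rewrite /f /= !(T, brE).
  by move: (d) (e) => d0 e0; apply/colP => i; rewrite !mxE; ring.
- rewrite /f /= !(T, brE).
  by move: (d) (e) => d0 e0; apply/colP => i; rewrite !mxE; ring.
- rewrite /f /= !(T, brE).
  by move: (d) (e) => d0 e0; apply/colP => i; rewrite !mxE; ring.
Qed.

End Classification.

Lemma g53_rigid : rigid_nil 3 (g53 R).
Proof.
split; first exact: g53_nilvar.
exists (\bigcup_(p in [set: 'rV[R]_5 * g * g * g])
  [set s | generic_at p.1.1.1 p.1.1.2 p.1.2 p.2 s != 0]).
  apply: bigcup_open => p _.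
  have := (open_comp _ (@open_neq R 0)).
  by apply => s _; exact: continuous_generic_at.
apply/seteqP; split=> [s [A uA <-]|s [[p _ /= gen] s3]]; last first.
  exact: generic_orbit s3 gen.
split; last exact: gl_act_nilvar g53_nilvar.
(* the standard basis and the last coordinate, transported by [A] *)
exists ((e5 R 4)^T *m invmx A, A *m e5 R 0, A *m e5 R 1, A *m e5 R 2) => //=.
rewrite /generic_at !br_gl_act !mulKmx // /val_at -!mulmxA !mulKmx //.
rewrite !e5_tr_mul //.
(* the value of [generic_at] is 1 *)
by rewrite !br_g53E !(coD, coZ) !co_e5 //=.
Qed.

End Rigidity.

(** * The cohomology of g53 *)

Section Cohomology.
Context {R : realType}.
Local Notation g := (vect R 5).
Implicit Types (nu : bil R 5) (x y z : g).
Let simp0 := (mul0r, mulr0, @oppr0 R, @addr0 R, @add0r R).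

Lemma nu1_cocycle : nu1 R \in cocycles 3 (g53 R).
Proof.
apply/cocyclesP; split; first exact: skew_of_alt.
  move=> i j l; have M := @co_br_g53 R; have N := @co_br_nu1 R.
  move: (basis_vect i) (basis_vect j) (basis_vect l) => x y z.
  move: (g53 R) (nu1 R) M N => mu nu M N.
  apply: co_inj; case=> [|[|[|[|[|//]]]]] _;
    rewrite !(coD, coN) !(M, N, simp0) /co ?mxE; ring.
move=> t; have M := @co_br_g53 R; have N := @co_br_nu1 R.
move: (g53 R) (nu1 R) M N (nth 0 _) => mu nu M N X /=.
apply: co_inj; case=> [|[|[|[|[|//]]]]] _;
  rewrite br0l addr0 !brDl !coD !(M, N, simp0) /co ?mxE; ring.
Qed.

Lemma nu2_cocycle : nu2 R \in cocycles 3 (g53 R).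
Proof.
apply/cocyclesP; split; first exact: skew_of_alt.
  move=> i j l; have M := @co_br_g53 R; have N := @co_br_nu2 R.
  move: (basis_vect i) (basis_vect j) (basis_vect l) => x y z.
  move: (g53 R) (nu2 R) M N => mu nu M N.
  apply: co_inj; case=> [|[|[|[|[|//]]]]] _;
    rewrite !(coD, coN) !(M, N, simp0) /co ?mxE; ring.
move=> t; have M := @co_br_g53 R; have N := @co_br_nu2 R.
move: (g53 R) (nu2 R) M N (nth 0 _) => mu nu M N X /=.
apply: co_inj; case=> [|[|[|[|[|//]]]]] _;
  rewrite br0l addr0 !brDl !coD !(M, N, simp0) /co ?mxE; ring.
Qed.

Lemma alt2_ext s t : s \in @alt2 R 5 -> t \in alt2 ->
  (forall i j, (i < j < 5)%N ->
     br s (e5 R i) (e5 R j) = br t (e5 R i) (e5 R j)) ->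
  s = t.
Proof.
move=> sk tk st; apply: bil_basisP => i j.
have E (k : 'I_5) : basis_vect k = e5 R k by rewrite /e5 inord_val.
rewrite !E; case: (ltngtP i j) => ij; first by rewrite st ?ij /=.
  by rewrite (br_skew sk) (br_skew tk) st ?ij /=.
by rewrite ij (br_alt sk) (br_alt tk).
Qed.

Definition cf nu i j k := co (br nu (e5 R i) (e5 R j)) k.

(** For goals [e = 0 -> cf nu i j k = r] whose premise is a cocycle equation:
    once the brackets are evaluated ([T]), oriented ([S]) and read in
    coordinates ([M], [cfE]), [e] is [cf nu i j k - r] up to sign. *)
Ltac solve_cf T S M cfE :=
  let h := fresh in
  rewrite /d2_at /= !(T, brE) ?S; rewrite !(coD, coN, co0, M);
  rewrite ?cfE ?co_e5 //=; move=> h; apply: subr0_eq;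
  first [ by apply: (etrans _ h); ring
        | by apply/oppr_inj; rewrite oppr0; apply: (etrans _ h); ring ].

(** The cocycle equations of [g53], solved.  The 17 coefficients that
    remain free are two more than for the coboundaries, on which [cf nu 0 2 2]
    vanishes and [cf nu 1 2 2] equals [cf nu 0 3 2]: these two account for the
    classes of [nu2] and [nu1]. *)
Lemma cocycle_cf nu : nu \in cocycles 3 (g53 R) ->
  ((cf nu 0 2 0 = 0) *
   (cf nu 0 2 1 = 0) *
   (cf nu 0 3 3 = - cf nu 0 1 1 - cf nu 0 4 4) *
   (cf nu 0 4 0 = 0) *
   (cf nu 0 4 1 = 0) *
   (cf nu 0 4 2 = 0) *
   (cf nu 0 4 3 = - cf nu 0 3 1) *
   (cf nu 1 2 0 = cf nu 0 3 0) *
   (cf nu 1 2 1 = cf nu 0 3 1) *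
   (cf nu 1 3 0 = 0) *
   (cf nu 1 3 1 = 0) *
   (cf nu 1 3 2 = 0) *
   (cf nu 1 3 3 = cf nu 0 1 0) *
   (cf nu 1 4 0 = 0) *
   (cf nu 1 4 1 = 0) *
   (cf nu 1 4 2 = 0) *
   (cf nu 1 4 3 = cf nu 0 3 0) *
   (cf nu 1 4 4 = - cf nu 0 3 2) *
   (cf nu 2 3 0 = 0) *
   (cf nu 2 3 1 = 0) *
   (cf nu 2 3 2 = 0) *
   (cf nu 2 3 3 = 0) *
   (cf nu 2 3 4 = cf nu 0 1 1 + cf nu 0 2 2 - cf nu 0 4 4 - cf nu 1 2 3) *
   (cf nu 2 4 0 = 0) *
   (cf nu 2 4 1 = 0) *
   (cf nu 2 4 2 = 0) *
   (cf nu 2 4 3 = 0) *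
   (cf nu 2 4 4 = cf nu 0 3 1) *
   (cf nu 3 4 0 = 0) *
   (cf nu 3 4 1 = 0) *
   (cf nu 3 4 2 = 0) *
   (cf nu 3 4 3 = 0) *
   (cf nu 3 4 4 = cf nu 0 3 0))%type.
Proof.
move=> /cocyclesP[sk d20 dN0].
have d2E (i j l k : nat) :
    co (d2_at (g53 R) nu (e5 R i) (e5 R j) (e5 R l)) k = 0.
  by rewrite d20 co0.
have dNE (i j l m k : nat) : co (Nk_lin (g53 R) nu 3
    (nth 0 [:: e5 R i; e5 R j; e5 R l; e5 R m])) k = 0.
  by have /= -> := dN0 [tuple inord i; inord j; inord l; inord m]; rewrite co0.
have skE (i j : nat) : br nu (e5 R i) (e5 R j) = - br nu (e5 R j) (e5 R i).
  exact: br_skew.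
pose S := (skE 1 0, skE 2 0, skE 2 1, skE 3 0, skE 3 1, skE 3 2, skE 4 0,
  skE 4 1, skE 4 2, skE 4 3, br_alt sk)%N.
have T := br_g53_e5 (R := R); have M := co_br_g53 (R := R).
move: (g53 R) d2E dNE T M => mu d2E dNE T M {d20 dN0}.
have cfE i j k : co (br nu (e5 R i) (e5 R j)) k = cf nu i j k by [].
have E040 : cf nu 0 4 0 = 0.
  by have := (dNE 0 1 0 0 0)%N; solve_cf T S M cfE.
have E041 : cf nu 0 4 1 = 0.
  by have := (dNE 0 1 0 0 1)%N; solve_cf T S M cfE.
have E042 : cf nu 0 4 2 = 0.
  by have := (dNE 0 1 0 0 2)%N; solve_cf T S M cfE.
have E043 : cf nu 0 4 3 = - cf nu 0 3 1.
  by have := (dNE 0 1 0 0 3)%N; solve_cf T S M cfE.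
have E033 : cf nu 0 3 3 = - cf nu 0 1 1 - cf nu 0 4 4.
  by have := (dNE 0 1 0 0 4)%N; solve_cf T S M cfE.
have E143 : cf nu 1 4 3 = cf nu 0 3 0.
  by have := (dNE 0 1 0 1 3)%N; solve_cf T S M cfE.
have E144 : cf nu 1 4 4 = - cf nu 0 3 2.
  by have := (dNE 0 1 0 1 4)%N; solve_cf T S M cfE.
have E243 : cf nu 2 4 3 = 0.
  by have := (dNE 0 1 0 2 3)%N; solve_cf T S M cfE.
have E244 : cf nu 2 4 4 = cf nu 0 3 1.
  by have := (dNE 0 1 0 2 4)%N; solve_cf T S M cfE.
have E343 : cf nu 3 4 3 = 0.
  by have := (dNE 0 1 0 3 3)%N; solve_cf T S M cfE.
have E344 : cf nu 3 4 4 = cf nu 0 3 0.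
  by have := (dNE 0 1 0 3 4)%N; solve_cf T S M cfE.
have E131 : cf nu 1 3 1 = 0.
  by have := (dNE 0 1 1 0 3)%N; solve_cf T S M cfE.
have E133 : cf nu 1 3 3 = cf nu 0 1 0.
  by have := (dNE 0 1 1 0 4)%N; solve_cf T S M cfE.
have E130 : cf nu 1 3 0 = 0.
  by have := (dNE 0 1 1 1 3)%N; solve_cf T S M cfE.
have E132 : cf nu 1 3 2 = 0.
  by have := (dNE 0 1 1 1 4)%N; solve_cf T S M cfE.
have E231 : cf nu 2 3 1 = 0.
  by have := (dNE 0 1 2 0 3)%N; solve_cf T S M cfE.
have E233 : cf nu 2 3 3 = 0.
  by have := (dNE 0 1 2 0 4)%N; solve_cf T S M cfE.
have E230 : cf nu 2 3 0 = 0.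
  by have := (dNE 0 1 2 1 3)%N; solve_cf T S M cfE.
have E232 : cf nu 2 3 2 = 0.
  by have := (dNE 0 1 2 1 4)%N; solve_cf T S M cfE.
have E021 : cf nu 0 2 1 = 0.
  by have := (dNE 0 2 0 0 4)%N; solve_cf T S M cfE.
have E020 : cf nu 0 2 0 = 0.
  by have := (dNE 0 2 1 0 4)%N; solve_cf T S M cfE.
have E121 : cf nu 1 2 1 = cf nu 0 3 1.
  by rewrite -[RHS]opprK -E043; have := (dNE 1 2 0 0 4)%N; solve_cf T S M cfE.
have E120 : cf nu 1 2 0 = cf nu 0 3 0.
  by rewrite -E143; have := (dNE 1 2 1 0 4)%N; solve_cf T S M cfE.
have E140 : cf nu 1 4 0 = 0.
  by have := (d2E 0 1 3 0)%N; solve_cf T S M cfE.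
have E141 : cf nu 1 4 1 = 0.
  by have := (d2E 0 1 3 1)%N; solve_cf T S M cfE.
have E142 : cf nu 1 4 2 = 0.
  by have := (d2E 0 1 3 2)%N; solve_cf T S M cfE.
have E340 : cf nu 3 4 0 = 0.
  by have := (d2E 0 1 4 0)%N; solve_cf T S M cfE.
have E341 : cf nu 3 4 1 = 0.
  by have := (d2E 0 1 4 1)%N; solve_cf T S M cfE.
have E342 : cf nu 3 4 2 = 0.
  by have := (d2E 0 1 4 2)%N; solve_cf T S M cfE.
have E240 : cf nu 2 4 0 = 0.
  by have := (d2E 0 2 3 0)%N; solve_cf T S M cfE.
have E241 : cf nu 2 4 1 = 0.
  by have := (d2E 0 2 3 1)%N; solve_cf T S M cfE.
have E242 : cf nu 2 4 2 = 0.
  by have := (d2E 0 2 3 2)%N; solve_cf T S M cfE.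
have E234 : cf nu 2 3 4 = cf nu 0 1 1 + cf nu 0 2 2 - cf nu 0 4 4 - cf nu 1 2 3.
  by have := (d2E 0 1 2 4)%N; solve_cf T S M cfE.
by do !split.
Qed.

Lemma cocycle_decomp nu : nu \in cocycles 3 (g53 R) ->
  exists f k1 k2, nu = d1 (g53 R) f + (k1 *: nu1 R + k2 *: nu2 R).
Proof.
move=> nuZ; have E := cocycle_cf nuZ.
have sk : nu \in alt2 by case/cocyclesP: nuZ.
(* column [j] is the image of [e5 j] under [f]; its entries solve the triangular
   system obtained by comparing coefficients *)
pose v := nth 0 [:: 0;
  of_co [:: cf nu 1 3 4 + cf nu 0 1 2; cf nu 0 1 3; 0; cf nu 0 1 4; 0];
  of_co [:: - cf nu 1 2 3 - cf nu 0 4 4; cf nu 0 2 3;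
            cf nu 1 2 4 - cf nu 0 1 3 - cf nu 0 3 4; cf nu 0 2 4; 0];
  of_co [:: - cf nu 0 1 0; - cf nu 0 2 2 - cf nu 0 1 1; - cf nu 0 1 2; 0; 0];
  of_co [:: - cf nu 0 3 0; - cf nu 0 3 1; - cf nu 0 3 2; cf nu 0 4 4;
            - cf nu 0 3 4]].
have skm : g53 R \in alt2 by case: (g53_nilvar (R := R)).
exists (frame v), (cf nu 1 2 2 - cf nu 0 3 2), (- cf nu 0 2 2).
apply: alt2_ext => //.
  apply: rpredD; first exact: d1_alt.
  by apply: rpredD; apply: rpredZ; exact: skew_of_alt.
have T := br_g53_e5 (R := R); have M := co_br_g53 (R := R).
have N1 := co_br_nu1 (R := R); have N2 := co_br_nu2 (R := R).
have D1 := @br_d1 R 5 (g53 R).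
move: (g53 R) (nu1 R) (nu2 R) T M N1 N2 D1 {nuZ skm} => mu m1 m2 T M N1 N2 D1.
move=> i j /andP[ij j5].
have F k : (k < 5)%N -> frame v *m e5 R k = v k by exact: frame_e5.
rewrite br_addl D1 br_addl !br_scalel !F ?(ltn_trans ij) //.
have cfE p q k : co (br nu (e5 R p) (e5 R q)) k = cf nu p q k by [].
have coE := co_of_co (R := R).
move: ij j5.
case: i => [|[|[|[|[|i]]]]]; case: j => [|[|[|[|[|j]]]]] //= _ _;
  rewrite T ?mulmxN ?mulmx0 ?F //;
  apply: co_inj; case=> [|[|[|[|[|//]]]]] _;
  rewrite !(coD, coN, coZ, co0, M, N1, N2, cfE) ?E;
  rewrite ?(co_e5, coE, co0) //=; ring.
Qed.

Lemma nu_coboundary (k1 k2 : R) :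
  k1 *: nu1 R + k2 *: nu2 R \in coboundaries (g53 R) -> k1 = 0 /\ k2 = 0.
Proof.
case/memv_imgP => f _; rewrite lfunE /= => fE.
have E i j k : co (br (k1 *: nu1 R + k2 *: nu2 R) (e5 R i) (e5 R j)) k =
   co (br (d1 (g53 R) f) (e5 R i) (e5 R j)) k by rewrite fE.
have T := br_g53_e5 (R := R); have M := co_br_g53 (R := R).
have N1 := co_br_nu1 (R := R); have N2 := co_br_nu2 (R := R).
have D1 := @br_d1 R 5 (g53 R).
move: (g53 R) (nu1 R) (nu2 R) T M N1 N2 D1 E {fE} => mu m1 m2 T M N1 N2 D1 E.
(* the [c]-coordinates of the values at [(b, c)], [(a, d)] and [(a, c)] *)
have := E 1%N 2%N 2%N; have := E 0%N 3%N 2%N; have := E 0%N 2%N 2%N.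
rewrite !br_addl !br_scalel !D1 !T mulmx0 !(coD, coN, coZ, co0, M, N1, N2).
rewrite !co_e5 //=; move: (co (f *m e5 R 4) 2) => f24 h02 h03 h12.
by split; lra.
Qed.

Lemma H2nil_span : H2nil 3 (g53 R) =
  <<[:: quot_class (coboundaries (g53 R)) (nu1 R);
        quot_class (coboundaries (g53 R)) (nu2 R)]>>%VS.
Proof.
rewrite /H2nil /quot_vspace; set q := quot_class _.
apply/eqP; rewrite eqEsubv; apply/andP; split; last first.
  apply/span_subvP => w; rewrite !inE => /orP[] /eqP ->; apply: memv_img.
    exact: nu1_cocycle.
  exact: nu2_cocycle.
apply/subvP => _ /memv_imgP[nu nuZ ->].
have [f [k1 [k2 ->]]] := cocycle_decomp nuZ.
have qd1 : q (d1 (g53 R) f) = 0.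
  by apply/eqP; rewrite quot_class_eq0 -[d1 _ f]lfunE memv_img ?memvf.
rewrite !linearD !linearZ /= qd1 add0r.
by apply: rpredD; apply: rpredZ; apply: memv_span; rewrite !inE eqxx ?orbT.
Qed.

Lemma nu_classes_free :
  free [:: quot_class (coboundaries (g53 R)) (nu1 R);
           quot_class (coboundaries (g53 R)) (nu2 R)].
Proof.
set q := quot_class _.
have indep (k1 k2 : R) : k1 *: q (nu1 R) + k2 *: q (nu2 R) = 0 ->
    k1 = 0 /\ k2 = 0.
  rewrite -!linearZ -linearD => /eqP.
  by rewrite quot_class_eq0 => /nu_coboundary.
rewrite free_cons span_seq1 seq1_free; apply/andP; split.
  apply/vlineP => -[k qE]; have [] := indep 1 (- k).
    by rewrite qE scale1r scaleNr subrr.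
  by move/eqP; rewrite oner_eq0.
apply/eqP => q0; have [] := indep 0 1.
  by rewrite q0 scale0r scaler0 addr0.
by move=> _ /eqP; rewrite oner_eq0.
Qed.

End Cohomology.

Theorem mainTheorem7 (R : realType) :
  rigid_nil 3 (g53 R) /\
  [/\ nu1 R \in cocycles 3 (g53 R),
      nu2 R \in cocycles 3 (g53 R) &
      (coboundaries (g53 R) <= cocycles 3 (g53 R))%VS] /\
  [/\ H2nil 3 (g53 R) <> 0%VS,
      \dim (H2nil 3 (g53 R)) = 2%N &
      H2nil 3 (g53 R) =
        <<[:: quot_class (coboundaries (g53 R)) (nu1 R);
              quot_class (coboundaries (g53 R)) (nu2 R)]>>%VS].
Proof.
have dimH : \dim (H2nil 3 (g53 R)) = 2%N.
  by rewrite H2nil_span (eqnP nu_classes_free).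
split; first exact: g53_rigid.
split; split=> //.
- exact: nu1_cocycle.
- exact: nu2_cocycle.
- exact: coboundaries_sub g53_nilvar.
- by move=> H0; move: dimH; rewrite H0 dimv0.
- exact: H2nil_span.
Qed.
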